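(* Let $G$ be a finite simple graph. Then either (i) $c_2(G) = \mathrm{mr}(G,\mathbb{F}_2)$, or (ii) $c_2(G) = \mathrm{mr}(G,\mathbb{F}_2)+1$, in which case $\mathrm{mr}(G,\mathbb{F}_2)$ is even.
   Context: All graphs are finite and simple. A subgraph complementation system for a graph $G=(V,E)$ is a finite collection (family) $\mathscr{C}$ of subsets of $V$ such that, for any two distinct vertices $u,v\in V$, $uv\in E$ if and only if $u$ and $v$ appear together in an odd number of sets in $\mathscr{C}$. The subgraph complementation number $c_2(G)$ is the minimum cardinality of a subgraph complementation system for $G$. A symmetric matrix over a field $\mathbb{F}$ with rows and columns indexed by $V$ fits $G$ if, for distinct $u,v$, its $(u,v)$ entry is nonzero if and only if $uv\in E$ (the diagonal is arbitrary). $\mathrm{mr}(G,\mathbb{F})$ is the minimum rank over $\mathbb{F}$ of a symmetric matrix over $\mathbb{F}$ which fits $G$. *)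

(* Defs.v *)
From mathcomp Require Import all_boot all_order all_algebra.
From mathcomp Require Import boolp.

Set Implicit Arguments.
Unset Strict Implicit.
Unset Printing Implicit Defensive.

Import GRing.Theory.

Record sgraph := SGraph {
  vertex :> finType;
  edge : rel vertex;
  edge_sym : symmetric edge;
  edge_irrefl : irreflexive edge
}.

Lemma exists_asbool (P : nat -> Prop) :
  (exists n, P n) -> exists n, `[< P n >].
Proof. by move=> [n Pn]; exists n; apply/asboolP. Qed.

Definition min_nat (P : nat -> Prop) (exP : exists n, P n) : nat :=
  ex_minn (exists_asbool exP).

Lemma min_natP (P : nat -> Prop) (exP : exists n, P n) :
  P (min_nat exP) /\ (forall n, P n -> min_nat exP <= n).
Proof.
rewrite /min_nat; case: ex_minnP => m /asboolP Pm minm.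
by split=> // n Pn; apply: minm; apply/asboolP.
Qed.

(* Families are sequences, so repeated sets are allowed and counted with
   multiplicity. *)
Definition subgraph_complementation_system (G : sgraph) (C : seq {set G}) :=
  forall u v : G, u != v ->
    edge u v = odd (count (fun S : {set G} => (u \in S) && (v \in S)) C).

Lemma exists_subgraph_complementation_system (G : sgraph) :
  exists k, exists2 C : seq {set G},
    subgraph_complementation_system C & size C = k.
Proof.
pose E := [set S : {set G} |
  [exists u, exists v, edge u v && (S == [set u; v])]].
exists (size (enum E)), (enum E) => // u v neq_uv.
have cardE2 S : S \in E -> #|S| = 2.
  rewrite inE => /existsP[x /existsP[y /andP[exy /eqP->]]].
  rewrite cards2; case: eqP exy => // ->; by rewrite edge_irrefl.
have inE2 : ([set u; v] \in E) = edge u v.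
  rewrite inE; apply/existsP/idP => [[x /existsP[y]]|euv]; last first.
    by exists u; apply/existsP; exists v; rewrite euv eqxx.
  case/andP=> exy /eqP/setP eq_uv.
  have /esym := eq_uv u; have /esym := eq_uv v.
  rewrite !inE !eqxx orbT /=.
  by case/orP=> /eqP Dv; case/orP=> /eqP Du; subst;
    rewrite ?eqxx // edge_sym in neq_uv exy *.
rewrite (@eq_in_count _ _ (pred1 [set u; v])).
  by rewrite count_uniq_mem ?enum_uniq // mem_enum inE2; case: (edge u v).
move=> S; rewrite mem_enum => /cardE2 cardS /=.
apply/andP/eqP => [[uS vS]|->]; last by rewrite !inE !eqxx orbT.
apply/esym/eqP; rewrite eqEcard cards2 neq_uv cardS leqnn andbT.
by apply/subsetP=> w /[!inE] /orP[]/eqP->.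
Qed.

Definition c2 (G : sgraph) : nat :=
  min_nat (exists_subgraph_complementation_system G).

Local Open Scope ring_scope.

(* The row and column of a vertex u have index [enum_rank u]. *)
Definition fits (F : fieldType) (G : sgraph) (M : 'M[F]_#|G|) :=
  M^T = M /\
  (forall u v : G, u != v -> (M (enum_rank u) (enum_rank v) != 0) = edge u v).

Lemma exists_fits (F : fieldType) (G : sgraph) :
  exists r, exists2 M : 'M[F]_#|G|, fits M & \rank M = r.
Proof.
pose A : 'M[F]_#|G| := \matrix_(i, j) (edge (enum_val i) (enum_val j))%:R.
exists (\rank A), A => //; split=> [|u v _].
  by apply/matrixP=> i j; rewrite !mxE edge_sym.
by rewrite mxE !enum_rankK; case: (edge u v); rewrite ?oner_eq0 ?eqxx.
Qed.

Definition mr (F : fieldType) (G : sgraph) : nat :=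
  min_nat (exists_fits F G).

(* Main.v *)
Require Import Defs.
From mathcomp Require Import all_boot all_order all_algebra.
From mathcomp Require Import ring.

(** A system of k sets is the same thing as k vectors x over F_2 whose squares
    x x^T add up to a symmetric matrix fitting G, so that mr <= c_2, and it
    remains to write a symmetric matrix M of rank r as a sum of few squares.
    A nonzero diagonal entry lets one split off a square and lower the rank by
    one.  If M has zero diagonal, a nonzero entry lets one split off y z^T + z y^T
    and lower the rank by two; hence r is even, and the identity
    x x^T + y z^T + z y^T
      = (x + y) (x + y)^T + (x + z) (x + z)^T + (x + y + z) (x + y + z)^T
    turns any x x^T + M into r + 1 squares (x = 0 included).  Splitting off squares
    until the remaining diagonal vanishes, r squares suffice when
    the diagonal is nonzero, and r + 1 when it is zero. *)

Set Implicit Arguments.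
Unset Strict Implicit.
Unset Printing Implicit Defensive.

Import GRing.Theory.

Local Open Scope ring_scope.

(** Subtracting a matrix of rank one lowers the rank by at most one. It does drop, since the new
    rows stay in the row space of [M] while column [j], nonzero in [M], becomes zero. *)
Lemma mxrank_Wedderburn (F : fieldType) (m n : nat) (M : 'M[F]_(m, n)) i j :
  M i j != 0 ->
  \rank M = (\rank (M - (M i j)^-1 *: (col j M *m row i M))).+1.
Proof.
move=> Mij; set N := M - _.
have sNM : (N <= M)%MS.
  rewrite addmx_sub // eqmx_opp scalemx_sub //.
  by rewrite (submx_trans (submxMl _ _)) // row_sub.
have N0 : N *m delta_mx j (0 : 'I_1) = 0.
  rewrite -colE; apply/matrixP => k l; rewrite !mxE big_ord1 !mxE.
  by rewrite mulrC mulfK // subrr.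
have Mj : \rank (M *m delta_mx j (0 : 'I_1)) = 1%N.
  apply/eqP; rewrite eqn_leq rank_leq_col lt0n mxrank_eq0 -colE.
  by apply: contra_neq Mij => /matrixP/(_ i 0); rewrite !mxE.
apply/eqP; rewrite eqn_leq; apply/andP; split.
  rewrite -addn1 -{1}(subrK ((M i j)^-1 *: (col j M *m row i M)) M).
  rewrite (leq_trans (mxrank_add _ _)) // leq_add2l.
  by rewrite (leq_trans (mxrank_scale _ _)) // (leq_trans (mulmx_max_rank _ _)).
rewrite -(mxrank_mul_ker M (delta_mx j (0 : 'I_1))) Mj ltnS mxrankS //.
by rewrite sub_capmx sNM; apply/sub_kermxP.
Qed.

Lemma natr_F2_neq0 (n : nat) : (n%:R != 0 :> 'F_2) = odd n.
Proof. by rewrite -(dvdn_pcharf (pchar_Fp _)) // dvdn2 negbK. Qed.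

Lemma F2_eq0_or1 (x : 'F_2) : x = (x != 0)%:R.
Proof. by case: x => [[|[|]]] // lt; apply: val_inj. Qed.

Lemma F2_neq0 (x : 'F_2) : x != 0 -> x = 1.
Proof. by move=> x0; rewrite (F2_eq0_or1 x) x0. Qed.

Definition sum_squares (R : nzRingType) (n : nat) (s : seq 'cV[R]_n) : 'M[R]_n :=
  \sum_(x <- s) x *m x^T.

Lemma mxrank_sum_squares (F : fieldType) n (s : seq 'cV[F]_n) :
  (\rank (sum_squares s) <= size s)%N.
Proof.
rewrite /sum_squares; elim: s => [|x s IHs]; first by rewrite big_nil mxrank0.
rewrite big_cons (leq_trans (mxrank_add _ _)) //=.
exact: leq_add (mulmx_max_rank _ _) IHs.
Qed.

Lemma trmx_sum_squares (F : fieldType) n (s : seq 'cV[F]_n) :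
  (sum_squares s)^T = sum_squares s.
Proof.
rewrite /sum_squares raddf_sum; apply: eq_bigr => x _ /=.
by rewrite trmx_mul trmxK.
Qed.

Lemma three_squares_pchar2 (R : comNzRingType) n (x y z : 'cV[R]_n) :
  2 \in [pchar R] ->
  x *m x^T + (y *m z^T + z *m y^T) =
  (x + y) *m (x + y)^T + ((x + z) *m (x + z)^T + (x + y + z) *m (x + y + z)^T).
Proof.
move=> R2; apply/matrixP => i j; rewrite !mxE !big_ord1 !mxE.
move: (x i _) (y i _) (z i _) (x j _) (y j _) (z j _) => a b c a' b' c'.
(* The right side exceeds the left by exactly [t + t]. *)
pose t := a * a' + b * b' + c * c' + a * b' + b * a' + a * c' + c * a'.
by rewrite -[LHS]addr0 -(addrr_pchar2 R2 t) /t; ring.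
Qed.

(** The arbitrary [x] carries the induction: of the three squares two are final, and that of [x + y]
    passes with the remainder [N] to the next step. *)
Lemma alternating_sum_squares_F2 n (M : 'M['F_2]_n) :
  M^T = M -> (forall i, M i i = 0) ->
  ~~ odd (\rank M) /\
  forall x : 'cV_n, exists2 s : seq 'cV_n,
    size s = (\rank M).+1 & x *m x^T + M = sum_squares s.
Proof.
have [r] := ubnP (\rank M); elim: r => // r IHr in M * => ltMr symM altM.
have [-> | /matrix0Pn[a [b Mab]]] := eqVneq M 0.
  rewrite mxrank0; split=> // x; exists [:: x] => //.
  by rewrite /sum_squares big_seq1 addr0.
have symE i j : M i j = M j i by rewrite -{1}symM mxE.
have Mba : M b a != 0 by rewrite symE.
pose y := col a M; pose z := col b M.
have rowM : row b M = z^T by apply/matrixP => i j; rewrite !mxE symE.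
have rkM := mxrank_Wedderburn Mba.
rewrite (F2_neq0 Mba) invr1 scale1r rowM -/y in rkM.
set N1 := M - _ in rkM.
(* As the diagonal of [M] vanishes, subtracting [y *m z^T] leaves column [b] and row [a] unchanged.
   Pivoting [N1] at the mirror entry thus subtracts [z *m y^T], which restores symmetry. *)
have N1ab : N1 a b != 0 by rewrite !mxE big_ord1 !mxE !altM mul0r subr0.
have rkN1 := mxrank_Wedderburn N1ab.
have colN1 : col b N1 = z.
  by apply/matrixP => i j; rewrite !mxE big_ord1 !mxE altM mulr0 subr0.
have rowN1 : row a N1 = y^T.
  by apply/matrixP => i j; rewrite !mxE big_ord1 !mxE altM mul0r subr0 symE.
rewrite colN1 rowN1 (F2_neq0 N1ab) invr1 scale1r in rkN1.
set N := N1 - _ in rkN1.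
have defM : M = (y *m z^T + z *m y^T) + N.
  by rewrite addrC [y *m _ + _]addrC addrA !subrK.
have symN : N^T = N.
  by rewrite !linearB /= !trmx_mul !trmxK symM /N /N1 addrAC.
have altN i : N i i = 0.
  rewrite !mxE !big_ord1 !mxE altM sub0r [M i b * _]mulrC.
  by rewrite oppr_pchar2 ?addrr_pchar2 ?pchar_Fp.
have [|evN sqN] := IHr N _ symN altN.
  by rewrite rkM rkN1 ltnS in ltMr; apply: ltnW.
rewrite rkM rkN1 /= negbK; split=> // x.
have [s sz_s Ds] := sqN (x + y).
exists [:: x + z, x + y + z & s]; first by rewrite /= sz_s.
rewrite defM addrA three_squares_pchar2 ?pchar_Fp // /sum_squares !big_cons.
by rewrite -/(sum_squares s) -Ds addrAC addrC -addrA.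
Qed.

Lemma nonalternating_sum_squares_F2 n (M : 'M['F_2]_n) :
  M^T = M -> (exists i, M i i != 0) ->
  exists2 s : seq 'cV_n, size s = \rank M & M = sum_squares s.
Proof.
have [r] := ubnP (\rank M); elim: r => // r IHr in M * => ltMr symM [i Mii].
pose x := col i M.
have rowM : row i M = x^T by rewrite /x -{1}symM tr_col.
have rkM := mxrank_Wedderburn Mii.
rewrite (F2_neq0 Mii) invr1 scale1r rowM -/x in rkM.
set N := M - _ in rkM.
have defM : M = x *m x^T + N by rewrite addrC subrK.
have symN : N^T = N by rewrite linearB /= trmx_mul trmxK symM.
have [/existsP nzN | ] := boolP [exists j, N j j != 0].
  have [|s sz_s Ds] := IHr N _ symN nzN; first by rewrite rkM in ltMr.
  exists (x :: s); first by rewrite rkM /= sz_s.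
  by rewrite /sum_squares big_cons -/(sum_squares s) -Ds.
rewrite negb_exists => /forallP altN.
(* The square just split off absorbs the extra one: [x *m x^T + N] takes [(\rank N).+1] squares,
   which is [\rank M]. *)
have [|_ /(_ x)[s sz_s Ds]] := alternating_sum_squares_F2 symN.
  by move=> j; apply/eqP; rewrite -[_ == _]negbK.
by exists s; rewrite ?rkM // defM.
Qed.

(** A vector over ['F_2] is the indicator of its support, so entry [(u, v)] of the sum counts modulo
    2 the supports containing both. The equation on [C] lets one start from vectors or from a given
    family. *)
Lemma fits_sum_squares_F2 (G : sgraph) (C : seq {set G}) (s : seq 'cV['F_2]_#|G|) :
  C = [seq [set u | x (enum_rank u) 0 != 0] | x : 'cV_#|G| <- s] ->
  fits (sum_squares s) <-> subgraph_complementation_system C.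
Proof.
move=> ->; set C' := map _ _.
have sE u v : sum_squares s (enum_rank u) (enum_rank v) =
    (count (fun S : {set G} => (u \in S) && (v \in S)) C')%:R.
  rewrite count_map -sum1_count natr_sum [RHS]big_mkcond summxE /=.
  apply: eq_bigr => x _; rewrite !mxE big_ord1 !mxE /= !inE.
  move: (x _ _) (x _ _) => p q; rewrite (F2_eq0_or1 p) (F2_eq0_or1 q).
  by case: (p != 0); case: (q != 0); rewrite ?mulr1 ?mulr0.
split=> [[_ sG] u v uv | sC]; first by rewrite -sG // sE natr_F2_neq0.
by split=> [|u v uv]; rewrite ?trmx_sum_squares // sC // sE natr_F2_neq0.
Qed.

Lemma c2_le_size (G : sgraph) (s : seq 'cV['F_2]_#|G|) :
  fits (sum_squares s) -> (c2 G <= size s)%N.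
Proof.
move=> /(fits_sum_squares_F2 erefl) sC.
have [_ minC] := min_natP (exists_subgraph_complementation_system G).
by apply: minC; eexists; first exact: sC; rewrite size_map.
Qed.

Lemma mr_F2_le_c2 (G : sgraph) : (mr 'F_2 G <= c2 G)%N.
Proof.
have [[C sC sz_C] _] := min_natP (exists_subgraph_complementation_system G).
have [_ minM] := min_natP (exists_fits 'F_2 G).
pose s : seq 'cV['F_2]_#|G| :=
  [seq \col_i (enum_val i \in A)%:R | A : {set G} <- C].
have fits_s : fits (sum_squares s).
  apply: (fits_sum_squares_F2 _).2 sC; rewrite -map_comp map_id_in // => A _.
  by apply/setP => u; rewrite /= inE !mxE enum_rankK; case: (u \in A).
rewrite /c2 -sz_C -(size_map _ C : size s = _).
by apply: leq_trans (mxrank_sum_squares s); apply: minM; exists (sum_squares s).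
Qed.

Theorem corollary4p7 (G : sgraph) :
  c2 G = mr 'F_2 G \/ (c2 G = (mr 'F_2 G).+1 /\ ~~ odd (mr 'F_2 G)).
Proof.
have le_mr := mr_F2_le_c2 G.
have [[M fitsM rkM] _] := min_natP (exists_fits 'F_2 G).
rewrite -/(mr _ G) in rkM; have symM := fitsM.1.
have [/existsP nzM | ] := boolP [exists i, M i i != 0].
  have [s sz_s Ds] := nonalternating_sum_squares_F2 symM nzM.
  rewrite Ds in fitsM; left; apply/eqP.
  by rewrite eqn_leq le_mr andbT -rkM -sz_s c2_le_size.
rewrite negb_exists => /forallP altM.
(* Here [x = 0] still costs a square, so only [c2 G <= (mr 'F_2 G).+1] follows. Both alternatives
   stay open, and [evM] supplies the parity for the second. *)
have [|evM /(_ 0)[s sz_s]] := alternating_sum_squares_F2 symM.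
  by move=> j; apply/eqP; rewrite -[_ == _]negbK.
rewrite mul0mx add0r => Ds; rewrite Ds in fitsM.
have := c2_le_size fitsM; rewrite sz_s rkM in evM *.
rewrite leq_eqVlt ltnS => /predU1P[-> | le_c2]; first by right.
by left; apply/eqP; rewrite eqn_leq le_c2.
Qed.
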